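(* Let $G=(V,E)$ be an instance of MFASP with Gallai–Edmonds decomposition $V=X\cup Y\cup Z$. Then: (i) for every optimal solution $(M^*,y^*,c^* )$: (a) $c^*_e=0$ for all $e\in E\setminus M^*$ and $0\le c^*_e\le 1$ for all $e\in M^*$; (b) $|M^*|=\nu(G)$, i.e. $M^*$ is a maximum-cardinality matching of $G$. (ii) there exists an optimal solution $(M^*,y^*,c^* )$ such that (c) $c^*$ is half-integral (i.e. $c^*\in\frac12\mathbb{Z}^E$), and (d) $y^*\in\{0,\frac12,1\}^V$ and $y^*_v>0$ for every $v\in Y$.
   Context: All graphs are finite, undirected and simple, with unit edge weights; $\nu(G)$ denotes the maximum cardinality of a matching. For $w\in\mathbb{R}^E_{\ge 0}$, a fractional $w$-vertex cover is $y\in\mathbb{R}^V_{\ge 0}$ with $y_u+y_v\ge w_{uv}$ for all $\{u,v\}\in E$. A feasible solution of MFASP is a triple $(M,y,c)$ where $c\in\mathbb{R}^E_{\ge 0}$, $M$ is a matching, $y$ is a fractional $(\mathbb{1}+c)$-vertex cover, and $\sum_{e\in M}(1+c_e)=\sum_{v\in V}y_v$ (equivalently, $(G,\mathbb{1}+c)$ is stable, $M$ is a maximum $(\mathbb{1}+c)$-weight matching and $y$ a minimum fractional $(\mathbb{1}+c)$-vertex cover). It is optimal if $\sum_{e\in E}c_e$ is minimum among all feasible solutions. Gallai–Edmonds decomposition: $X$ is the set of vertices exposed by at least one maximum-cardinality matching, $Y$ the set of vertices not in $X$ adjacent to a vertex of $X$ (the Tutte set), $Z=V\setminus(X\cup Y)$.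 *)

(* Defs.v *)
From mathcomp Require Import all_boot all_order all_algebra.
From mathcomp Require Import reals.

Set Implicit Arguments.
Unset Strict Implicit.
Unset Printing Implicit Defensive.

Import Order.TTheory GRing.Theory Num.Theory.

Local Open Scope ring_scope.

(* A graph is a relation [adj] on a finType; simplicity (symmetric and
   irreflexive [adj]) is assumed in the theorem.  An edge {u, v} is the set
   [set u; v]. *)
Definition edges (V : finType) (adj : rel V) : {set {set V}} :=
  [set [set u; v] | u in V, v in adj u].

(* [trivIset M]: the members of M are pairwise disjoint. *)
Definition matching (V : finType) (adj : rel V) (M : {set {set V}}) : bool :=
  (M \subset edges adj) && trivIset M.

Definition nu (V : finType) (adj : rel V) : nat :=
  \max_(M : {set {set V}} | matching adj M) #|M|.

Definition max_matching (V : finType) (adj : rel V) (M : {set {set V}}) : bool :=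
  matching adj M && (#|M| == nu adj).

(* Edge vectors in R^E are functions on {set V}; only their values on
   [edges adj] are ever used. *)
Definition frac_vertex_cover (R : realType) (V : finType) (adj : rel V)
    (w : {set V} -> R) (y : V -> R) : Prop :=
  (forall v, 0 <= y v) /\
  (forall u v, adj u v -> w [set u; v] <= y u + y v).

Definition feasible (R : realType) (V : finType) (adj : rel V)
    (M : {set {set V}}) (y : V -> R) (c : {set V} -> R) : Prop :=
  [/\ forall e, e \in edges adj -> 0 <= c e,
      matching adj M,
      frac_vertex_cover adj (fun e => 1 + c e) y
    & \sum_(e in M) (1 + c e) = \sum_(v : V) y v].

Definition optimal (R : realType) (V : finType) (adj : rel V)
    (M : {set {set V}}) (y : V -> R) (c : {set V} -> R) : Prop :=
  feasible adj M y c /\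
  forall (M' : {set {set V}}) (y' : V -> R) (c' : {set V} -> R),
    feasible adj M' y' c' ->
    \sum_(e in edges adj) c e <= \sum_(e in edges adj) c' e.

(* Gallai-Edmonds decomposition; [cover M] is the set of vertices matched
   by M. *)
Definition GE_X (V : finType) (adj : rel V) : {set V} :=
  [set v | [exists M : {set {set V}}, max_matching adj M && (v \notin cover M)]].

Definition GE_Y (V : finType) (adj : rel V) : {set V} :=
  [set v | (v \notin GE_X adj) && [exists u, (u \in GE_X adj) && adj u v]].

Definition GE_Z (V : finType) (adj : rel V) : {set V} :=
  ~: (GE_X adj :|: GE_Y adj).

Definition half_integral (R : realType) (x : R) : Prop :=
  exists k : int, x = k%:~R / 2.

(* Main.v *)
Require Import Defs.
From mathcomp Require Import all_boot all_order all_algebra.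
From mathcomp Require Import reals lra.

Set Implicit Arguments.
Unset Strict Implicit.
Unset Printing Implicit Defensive.

Import Order.TTheory GRing.Theory Num.Theory.

Local Open Scope ring_scope.

(* In a feasible triple (M, y, c) the edges of M are tight and y vanishes outside
   the vertices covered by M, so the least cost for given M and y is y(V) - |M|,
   attained by a subsidy supported on M.  Optimality thus forces c = 0 off M and
   y <= 1, and since some maximum matching covers every vertex covered by M,
   replacing M by it would be cheaper unless |M| = nu(G).  For (ii), y can be
   rounded to {0, 1/2, 1} without changing M or increasing y(V), so a minimum
   exists among finitely many pairs; finally the zeros of y that no alternating
   path from an exposed vertex reaches are raised to 1/2 while their mates drop
   from 1 to 1/2, after which every zero of y can be exposed by a maximum
   matching, that is, lies in X. *)

(** * Matchings: edge exchange and maximum matchings *)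

Section Matchings.
Variables (V : finType) (adj : rel V).
Hypotheses (adj_sym : symmetric adj) (adj_irr : irreflexive adj).
Implicit Types (M N : {set {set V}}) (e f : {set V}) (u v : V).

Lemma edgesP e :
  reflect (exists u v, adj u v /\ e = [set u; v]) (e \in edges adj).
Proof.
apply: (iffP imset2P) => [[u v _ uv ->]|[u [v [uv ->]]]]; first by exists u, v.
by exists u v.
Qed.

Lemma adj_neq u v : adj u v -> u != v.
Proof. by apply: contraTneq => ->; rewrite adj_irr. Qed.

Lemma edges_mem u e : e \in edges adj -> u \in e ->
  exists2 v, adj u v & e = [set u; v].
Proof.
move=> /edgesP[a [b [ab ->]]]; rewrite !inE => /orP[]/eqP->; first by exists b.
by exists a; rewrite 1?adj_sym // setUC.
Qed.

Lemma edges_adj u v : [set u; v] \in edges adj -> adj u v.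
Proof.
move=> uvE; have [|w uw /setP/(_ w)] := edges_mem (u := u) uvE.
  by rewrite !inE eqxx.
rewrite !inE eqxx orbT => /orP[]/eqP ew; last by rewrite -ew.
by rewrite ew adj_irr in uw.
Qed.

Lemma matching_edges M e : matching adj M -> e \in M -> e \in edges adj.
Proof. by move=> /andP[/subsetP sME _] /sME. Qed.

Lemma matching_eq M e f v :
  matching adj M -> e \in M -> f \in M -> v \in e -> v \in f -> e = f.
Proof.
move=> /andP[_ /trivIsetP tM] eM fM ve vf; apply/eqP/negPn/negP => nef.
by have /pred0P/(_ v)/= := tM _ _ eM fM nef; rewrite ve vf.
Qed.

Lemma matching_mem M u : matching adj M -> u \in cover M ->
  exists v, adj u v /\ [set u; v] \in M.
Proof.
move=> mM /bigcupP[e eM ue].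
have [v uv ee] := edges_mem (matching_edges mM eM) ue.
by exists v; split=> //; rewrite -ee.
Qed.

Lemma mem_cover M e v : e \in M -> v \in e -> v \in cover M.
Proof. by move=> eM ve; apply/bigcupP; exists e. Qed.

Lemma cover_rem M e v : matching adj M -> e \in M ->
  (v \in cover (M :\ e)) = (v \in cover M) && (v \notin e).
Proof.
move=> mM eM; apply/bigcupP/andP => [[f]|[/bigcupP[f fM vf] ve]].
  rewrite !inE => /andP[nfe fM] vf; split; first exact: mem_cover vf.
  by apply: contra nfe => ve; rewrite (matching_eq mM fM eM vf ve).
by exists f => //; rewrite !inE fM andbT; apply: contraNneq ve => <-.
Qed.

Lemma matching_rem M e : matching adj M -> matching adj (M :\ e).
Proof.
move=> /andP[sME tM]; apply/andP; split.
  exact: subset_trans (subsetDl _ _) sME.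
exact: trivIsetS (subsetDl _ _) tM.
Qed.

Lemma matching_add M e : matching adj M -> e \in edges adj ->
  (forall v, v \in e -> v \notin cover M) ->
  matching adj (e |: M) /\ #|e |: M| = #|M|.+1.
Proof.
move=> mM eE eM; split; last first.
  rewrite cardsU1; suff -> : e \notin M by [].
  have /edgesP[u [v [uv ee]]] := eE.
  apply/negP => eM'; have := eM u; rewrite ee !inE eqxx => /(_ isT)/negP; apply.
  by apply: mem_cover eM' _; rewrite ee !inE eqxx.
have /andP[sME /trivIsetP tM] := mM.
apply/andP; split; first by rewrite subUset sub1set eE.
apply/trivIsetP => f g; rewrite !inE.
have dis h : h \in M -> [disjoint e & h].
  move=> hM; apply/pred0P => v /=; apply/negP => /andP[ve vh].
  by move: (eM v ve); rewrite (mem_cover hM vh).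
case/orP=> [/eqP->|fM] /orP[/eqP->|gM]; rewrite ?eqxx // => nfg.
- exact: dis.
- by rewrite disjoint_sym; apply: dis.
- exact: tM.
Qed.

(** Removing [f] frees its endpoints, and [e] meets no other covered vertex. *)
Lemma matching_swap M e f : matching adj M -> e \in edges adj -> f \in M ->
  (forall v, v \in e -> v \in cover M -> v \in f) ->
  matching adj (e |: (M :\ f)) /\ #|e |: (M :\ f)| = #|M|.
Proof.
move=> mM eE fM ef.
have [|m ->] := matching_add (matching_rem f mM) eE.
  move=> v ve; rewrite cover_rem // negb_and negbK.
  by case: (boolP (v \in cover M)) => //= /(ef v ve).
by split=> //; rewrite [RHS](cardsD1 f) fM.
Qed.

Lemma matching_card M : matching adj M -> (#|M| <= nu adj)%N.
Proof. by move=> mM; apply: (leq_bigmax_cond (F := fun M => #|M|)). Qed.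

Lemma matching0 : matching adj set0.
Proof. by rewrite /matching sub0set /trivIset /cover !big_set0 cards0 eqxx. Qed.

Lemma max_matching_exists : exists M, max_matching adj M.
Proof.
have [|M mM eM] := @eq_bigmax_cond _ (matching adj) (fun M => #|M|).
  by apply/card_gt0P; exists set0; apply: matching0.
by exists M; apply/andP; split; [exact: mM|apply/eqP; exact: esym eM].
Qed.

(** Otherwise [e] could be added, giving more than [nu adj] edges. *)
Lemma max_matching_maximal M e : max_matching adj M -> e \in edges adj ->
  exists2 v, v \in e & v \in cover M.
Proof.
move=> /andP[mM /eqP cM] eE.
have [/existsP[v /andP[ve vM]]|] := boolP [exists v, (v \in e) && (v \in cover M)].
  by exists v.
rewrite negb_exists => /forallP eM.
have [|m cm] := matching_add mM eE.
  by move=> v ve; have := eM v; rewrite ve.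
by have := matching_card m; rewrite cm cM ltnn.
Qed.

(* Among maximum matchings take one sharing the most edges with [M]: a vertex of
   [M] it misses would allow an exchange that gains a common edge. *)
Lemma max_matching_covering M : matching adj M ->
  exists2 N, max_matching adj N & cover M \subset cover N.
Proof.
move=> mM; have [N0 mN0] := max_matching_exists.
case: (arg_maxnP (fun N => #|M :&: N|) mN0) => N mN maxN.
exists N => //; apply/subsetP => v vM; apply/negPn/negP => vN.
have [w [vw eM]] := matching_mem mM vM.
have eE := matching_edges mM eM.
(* By maximality [N] covers an endpoint of the edge [vw] of [M]; as it misses [v], it covers [w]. *)
have [z ze zN] := max_matching_maximal mN eE.
have wN : w \in cover N.
  by move: ze vN zN; rewrite !inE => /orP[]/eqP-> => [/negPf->|].
have /andP[mN' /eqP cN] := mN.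
have [x [wx fN]] := matching_mem mN' wN.
have [|m cm] := matching_swap mN' eE fN.
  move=> u; rewrite !inE => /orP[]/eqP->; rewrite ?eqxx //.
  by move=> vN'; rewrite vN' in vN.
have vf : v \notin [set w; x].
  by apply: contra vN => vf; apply: mem_cover vf.
have := maxN _ (_ : max_matching adj ([set v; w] |: N :\ [set w; x])).
rewrite /max_matching m cm cN eqxx => /(_ isT).
rewrite /geq /= leqNgt => /negP; apply.
apply: proper_card; apply/properP; split; last first.
  exists [set v; w]; first by rewrite !inE eM eqxx.
  rewrite inE eM /=; apply: contra vN => eN.
  by apply: mem_cover eN _; rewrite !inE eqxx.
(* The edge given up, [wx], is not in [M], whose edge at [w] is [vw]; so no common edge is lost. *)
apply/subsetP => g; rewrite !inE => /andP[gM gN]; rewrite gM gN andbT /=.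
case: eqP => //= _; apply: contraTneq gM => ->; apply/negP => fM.
case/negP: vf; rewrite (_ : [set w; x] = [set v; w]) ?inE ?eqxx //.
by apply: (matching_eq (v := w) mM fM eM); rewrite !inE eqxx ?orbT.
Qed.

End Matchings.

(** * Feasible triples as covers supported on a matching *)

Section SupportedCovers.
Variables (R : realType) (V : finType) (adj : rel V).
Hypotheses (adj_sym : symmetric adj) (adj_irr : irreflexive adj).
Implicit Types (M : {set {set V}}) (y : V -> R) (c : {set V} -> R).

(** These are the pairs that extend to a feasible triple, with the subsidy eliminated. The
    definition is boolean so that a minimum can be taken over a finite type. *)
Definition supported_cover M y : bool :=
  [&& matching adj M,
      [forall v, 0 <= y v],
      [forall u, forall v, adj u v ==> (1 <= y u + y v)]
    & [forall v, (v \notin cover M) ==> (y v == 0)]].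

Lemma supported_coverP M y : reflect
  [/\ matching adj M, forall v, 0 <= y v,
      forall u v, adj u v -> 1 <= y u + y v
    & forall v, v \notin cover M -> y v = 0]
  (supported_cover M y).
Proof.
apply: (iffP and4P) => -[mM y0 yE yM]; split=> //.
- exact/forallP.
- by move=> u v uv; move/forallP/(_ u)/forallP/(_ v)/implyP: yE; apply.
- by move=> v vM; apply/eqP; move/forallP/(_ v)/implyP: yM; apply.
- exact/forallP.
- by apply/forallP=> u; apply/forallP=> v; apply/implyP; apply: yE.
- by apply/forallP=> v; apply/implyP=> /yM/eqP.
Qed.

Lemma sum_edge y e : e \in edges adj ->
  exists u v, [/\ adj u v, e = [set u; v] & \sum_(x in e) y x = y u + y v].
Proof.
move=> /edgesP[u [v [uv ->]]]; exists u, v; split=> //.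
by rewrite big_setU1 ?big_set1 // inE (adj_neq adj_irr uv).
Qed.

Lemma sum_matching M y : matching adj M ->
  \sum_(e in M) \sum_(v in e) y v = \sum_(v in cover M) y v.
Proof. by case/andP=> _ tM; rewrite -big_trivIset. Qed.

Lemma sum_supported M y : matching adj M ->
  (forall v, v \notin cover M -> y v = 0) ->
  \sum_(e in M) \sum_(v in e) y v = \sum_v y v.
Proof.
move=> mM yM; rewrite sum_matching // [RHS](bigID (mem (cover M))) /=.
by rewrite [X in _ + X]big1 ?addr0.
Qed.

(** Complementary slackness: the sum of [1 + c] over [M] is at most the sum of [y] over [cover M],
    hence at most its sum over [V]. The two ends agree, so both gaps vanish, and they vanish term by
    term. *)
Lemma feasible_supported M y c : feasible adj M y c ->
  supported_cover M y /\ forall e, e \in M -> c e = \sum_(v in e) y v - 1.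
Proof.
move=> [c0 mM [y0 yE] eqs].
have le e : e \in M -> 1 + c e <= \sum_(v in e) y v.
  by move=> /(matching_edges mM)/(sum_edge y)[u [v [uv -> ->]]]; apply: yE.
have split_y : \sum_v y v =
    \sum_(e in M) \sum_(v in e) y v + \sum_(v | v \notin cover M) y v.
  by rewrite sum_matching // [LHS](bigID (mem (cover M))).
have le_sum : \sum_(e in M) (1 + c e) <= \sum_(e in M) \sum_(v in e) y v.
  exact: ler_sum.
have ge0 : 0 <= \sum_(v | v \notin cover M) y v by apply: sumr_ge0.
have sum0 : \sum_(v | v \notin cover M) y v = 0 by lra.
have tight : \sum_(e in M) (\sum_(v in e) y v - (1 + c e)) = 0.
  by rewrite sumrB; lra.
split.
  apply/supported_coverP; split=> //.
    move=> u v uv; apply: le_trans (yE u v uv); rewrite lerDl c0 //.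
    by apply/edgesP; exists u, v.
  by move=> v vM; apply: (psumr_eq0P _ sum0).
have tight0 : forall e, e \in M -> \sum_(v in e) y v - (1 + c e) = 0.
  by apply: (psumr_eq0P _ tight) => e eM; rewrite subr_ge0 le.
by move=> e /tight0; lra.
Qed.

(** The cheapest subsidy for [M] and [y]: the forced value on [M], zero elsewhere. *)
Definition tight_subsidy M y (e : {set V}) : R :=
  if e \in M then \sum_(v in e) y v - 1 else 0.

Lemma sum_subsidy M (c : {set V} -> R) : matching adj M ->
  \sum_(e in edges adj) c e =
  \sum_(e in M) c e + \sum_(e in edges adj | e \notin M) c e.
Proof.
move=> mM; rewrite [LHS](bigID (mem M)) /=; congr (_ + _).
apply: eq_bigl => e; rewrite andbC.
by case: (boolP (e \in M)) => //= /(matching_edges mM).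
Qed.

Lemma sum_tight M y c : supported_cover M y ->
  (forall e, e \in M -> c e = \sum_(v in e) y v - 1) ->
  \sum_(e in M) c e = \sum_v y v - #|M|%:R.
Proof.
move=> /supported_coverP[mM _ _ yM] cM.
by rewrite (eq_bigr _ cM) sumrB sum_supported // sumr_const.
Qed.

(** Converse of [feasible_supported]; it reduces the problem to minimising [y(V) - |M|] over
    supported covers. *)
Lemma supported_feasible M y : supported_cover M y ->
  feasible adj M y (tight_subsidy M y) /\
  \sum_(e in edges adj) tight_subsidy M y e = \sum_v y v - #|M|%:R.
Proof.
move=> sMy; have /supported_coverP[mM y0 yE yM] := sMy.
have tM e : e \in M -> tight_subsidy M y e = \sum_(v in e) y v - 1.
  by rewrite /tight_subsidy => ->.
split; last first.
  rewrite (sum_subsidy _ mM) (sum_tight sMy tM) [X in _ + X]big1 ?addr0 // => e.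
  by rewrite /tight_subsidy => /andP[_ /negPf->].
split=> //.
- move=> e eE; rewrite /tight_subsidy; case: ifP => // _.
  by have [u [v [uv _ ->]]] := sum_edge y eE; rewrite subr_ge0 yE.
- split=> // u v uv; rewrite /tight_subsidy.
  case: ifP => _; last by rewrite addr0 yE.
  by rewrite big_setU1 ?big_set1 ?inE ?(adj_neq adj_irr uv) // addrC subrK.
- by rewrite big_split /= (sum_tight sMy tM) sumr_const addrC subrK.
Qed.

Lemma optimal_le M y c : optimal adj M y c -> forall N z, supported_cover N z ->
  \sum_(e in edges adj) c e <= \sum_v z v - #|N|%:R.
Proof.
by move=> [_ opt] N z /supported_feasible[f <-]; apply: opt f.
Qed.

(** An endpoint capped at 1 covers its edges alone. *)
Lemma supported_cover_min1 M y :
  supported_cover M y -> supported_cover M (fun v => Num.min (y v) 1).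
Proof.
move=> /supported_coverP[mM y0 yE yM]; apply/supported_coverP; split=> //.
- by move=> v; rewrite le_min y0 ler01.
- move=> u v uv; have := yE u v uv; have := y0 u; have := y0 v.
  rewrite /Num.min.
  by case: (ltP (y u) 1) => ?; case: (ltP (y v) 1) => ?; lra.
- by move=> v /yM->; rewrite /Num.min ltr01.
Qed.

Lemma optimal_structure M y c : optimal adj M y c ->
  [/\ forall e, e \in edges adj -> e \notin M -> c e = 0,
      forall e, e \in M -> 0 <= c e <= 1
    & #|M| = nu adj].
Proof.
move=> opt; have opt_le := optimal_le opt.
have [feas _] := opt; have [c0 mM _ _] := feas.
have [sMy cM] := feasible_supported feas.
have sumc := sum_subsidy c mM; rewrite (sum_tight sMy cM) in sumc.
have off_ge0 : 0 <= \sum_(e in edges adj | e \notin M) c e.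
  by apply: sumr_ge0 => e /andP[eE _]; apply: c0.
have /supported_coverP[_ y0 yE yM] := sMy.
split.
(* Comparison with [tight_subsidy M y], which costs what [c] spends on [M]. *)
- have off0 : \sum_(e in edges adj | e \notin M) c e = 0.
    by have := opt_le _ _ sMy; lra.
  move=> e eE eM; apply: (psumr_eq0P _ off0); last by rewrite eE.
  by move=> f /andP[fE _]; apply: c0.
(* Comparison with [y] capped at 1: capping cannot lower the total, so it changes no value. *)
- have sum1 : \sum_v (y v - Num.min (y v) 1) = 0.
    apply/eqP; rewrite eq_le sumr_ge0 ?andbT; last first.
      by move=> v _; rewrite subr_ge0 ge_min lexx.
    by rewrite sumrB; have := opt_le _ _ (supported_cover_min1 sMy); lra.
  have y1 v : y v <= 1.
    have /eqP : y v - Num.min (y v) 1 = 0.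
      by apply: (psumr_eq0P _ sum1) => // u _; rewrite subr_ge0 ge_min lexx.
    by rewrite subr_eq0 => /eqP->; rewrite ge_min lexx orbT.
  move=> e eM; rewrite c0 ?(matching_edges mM) // cM //=.
  have [u [v [_ _ ->]]] := sum_edge y (matching_edges mM eM).
  by have := y1 u; have := y1 v; lra.
(* Comparison with a maximum matching [N]: since it covers all that [M] covers, [y] is supported on
   it too. *)
- have [N /andP[mN /eqP cN] MN] := max_matching_covering adj_sym mM.
  have sNy : supported_cover N y.
    apply/supported_coverP; split=> // v vN; apply: yM; apply: contra vN.
    exact: (subsetP MN).
  apply/eqP; rewrite eqn_leq matching_card //= -cN -(ler_nat R).
  by have := opt_le _ _ sNy; lra.
Qed.

End SupportedCovers.

(** * Rounding covers to the values 0, 1/2 and 1 *)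

Section HalfIntegrality.
Variables (R : realType) (V : finType) (adj : rel V).
Hypotheses (adj_sym : symmetric adj) (adj_irr : irreflexive adj).
Implicit Types (M : {set {set V}}) (y : V -> R) (c : {set V} -> R).

Definition half_valued (x : R) : bool := [|| x == 0, x == 1 / 2 | x == 1].

Lemma half_valuedP x : reflect [\/ x = 0, x = 1 / 2 | x = 1] (half_valued x).
Proof. by apply: (iffP or3P) => -[/eqP|/eqP|/eqP] ?; constructor. Qed.

(* One rounding step: the fractional values on either side of 1/2 move
   symmetrically, in the direction which does not increase the total, until one
   of them becomes half-integral. *)
Lemma half_valued_step M y : supported_cover adj M y -> (forall v, y v <= 1) ->
  (exists v, ~~ half_valued (y v)) ->
  exists z, [/\ supported_cover adj M z, forall v, z v <= 1,
    \sum_v z v <= \sum_v y v &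
    (#|[set v | ~~ half_valued (z v)]| < #|[set v | ~~ half_valued (y v)]|)%N].
Proof.
move=> /supported_coverP[mM y0 yE yM] y1 [v0 nv0].
pose lo v := (0 < y v) && (y v < 1 / 2).
pose hi v := (1 / 2 < y v) && (y v < 1).
(* High and low values move oppositely, so an edge joining a high and a low vertex keeps its sum;
   the values 0, 1/2 and 1 stay fixed. *)
pose shift (a : R) v := y v + (if hi v then a else if lo v then - a else 0).
have caseP v : [\/ [/\ lo v, ~~ hi v, 0 < y v & y v < 1 / 2],
                   [/\ hi v, ~~ lo v, 1 / 2 < y v & y v < 1] |
                   [/\ ~~ lo v, ~~ hi v & half_valued (y v)]].
  rewrite /lo /hi /half_valued; have := y0 v; have := y1 v.
  case: (ltgtP (y v) 0) => //= h0; case: (ltgtP (y v) (1 / 2)) => //= h1;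
    case: (ltgtP (y v) 1) => //= h2 _ _; try lra;
    try (by constructor 1); try (by constructor 2); try (by constructor 3).
have fracN v : lo v || hi v -> ~~ half_valued (y v).
  by case/orP=> /andP[? ?]; apply/negP=> /half_valuedP[]; lra.
have sum_shift a : \sum_v shift a v =
    \sum_v y v + a * (\sum_v ((hi v)%:R - (lo v)%:R)).
  rewrite big_split /= mulr_sumr; congr (_ + _); apply: eq_bigr => v _.
  by case: (caseP v) => -[]; case: (lo v); case: (hi v) => //=; lra.
(* Half-valued vertices do not move, so one new half-valued vertex lowers the count. *)
have progress a v : half_valued (shift a v) -> ~~ half_valued (y v) ->
    (#|[set v | ~~ half_valued (shift a v)]| <
     #|[set v | ~~ half_valued (y v)]|)%N.
  move=> hv nv; apply: proper_card; apply/properP; split.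
    apply/subsetP => u; rewrite !inE.
    case: (caseP u) => [[_ _ u0 u1]|[_ _ u0 u1]|].
    - move=> _; apply/negP => /half_valuedP[]; lra.
    - move=> _; apply/negP => /half_valuedP[]; lra.
    - by case=> /negPf l /negPf h hu; rewrite /shift l h addr0 hu.
  by exists v; rewrite !inE ?nv ?hv.
have supp a v : v \notin cover M -> shift a v = 0.
  by move=> /yM y0v; rewrite /shift /lo /hi y0v ltxx /= ltNge divr_ge0 //= addr0.
set d := \sum_v _ in sum_shift.
(* [d] counts high minus low vertices, the rate of change of the total in [a]; its sign selects the
   direction. *)
have [d_ge0|d_le0] := leP 0 d.
(* Towards 1/2, by the least distance to it: no value crosses 1/2, so an edge with two high ends
   stays covered, and a minimiser lands on 1/2. *)
- pose dist v := `|y v - 1 / 2|.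
  case: (@arg_minP _ R V v0 (fun v => ~~ half_valued (y v)) dist nv0).
  move=> v nv minv.
  have dv : 0 < dist v.
    rewrite normr_gt0; apply: contraNneq nv => h; apply/half_valuedP.
    by constructor 2; lra.
  have lo_le u : lo u -> dist v <= 1 / 2 - y u.
    move=> lu; apply: le_trans (minv u (fracN u _)) _; first by rewrite lu ?orbT.
    by move: lu => /andP[? ?]; rewrite /dist ler0_norm; lra.
  have hi_le u : hi u -> dist v <= y u - 1 / 2.
    move=> lu; apply: le_trans (minv u (fracN u _)) _; first by rewrite lu ?orbT.
    by move: lu => /andP[? ?]; rewrite /dist ger0_norm; lra.
  exists (shift (- dist v)); split.
  + apply/supported_coverP; split=> //; last by move=> u; apply: supp.
    * move=> u; rewrite /shift; have := y0 u; case: ifP => [/hi_le|_]; [lra|].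
      by case: ifP => _; lra.
    * move=> u w /yE; rewrite /shift.
      move: (caseP u) (caseP w) =>
        [[lu hu u0 u1]|[hu lu u0 u1]|[lu hu /half_valuedP u0]]
        [[lw hw w0 w1]|[hw lw w0 w1]|[lw hw /half_valuedP w0]];
        try (have := lo_le _ lu); try (have := hi_le _ hu);
        try (have := lo_le _ lw); try (have := hi_le _ hw);
        rewrite ?hu ?lu ?hw ?lw ?(negPf hu) ?(negPf lu) ?(negPf hw) ?(negPf lw);
        try (case: u0); try (case: w0); lra.
  + move=> u; rewrite /shift; have := y1 u; case: ifP => _; [lra|].
    by case: ifP => [/lo_le|_]; lra.
  + by rewrite sum_shift; have := mulr_ge0 (ltW dv) d_ge0; lra.
  + apply: (progress _ v) => //; apply/half_valuedP; constructor 2.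
    rewrite /shift /dist; move: (caseP v) => [[-> /negPf-> v1 v2]|[-> _ v1 v2]|[_ _ h]].
    * by rewrite ler0_norm; lra.
    * by rewrite ger0_norm; lra.
    * by rewrite h in nv.
(* Away from 1/2, by the least distance to 0 or 1: no value leaves the interval from 0 to 1, and a
   minimiser lands on 0 or 1. *)
- pose dist v := Num.min (y v) (1 - y v).
  case: (@arg_minP _ R V v0 (fun v => ~~ half_valued (y v)) dist nv0).
  move=> v nv minv.
  have dv : 0 <= dist v.
    by rewrite /dist le_min y0; have := y1 v; lra.
  have lo_le u : lo u -> dist v <= y u.
    move=> lu; apply: le_trans (minv u (fracN u _)) _; first by rewrite lu ?orbT.
    by rewrite ge_min lexx.
  have hi_le u : hi u -> dist v <= 1 - y u.
    move=> lu; apply: le_trans (minv u (fracN u _)) _; first by rewrite lu ?orbT.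
    by rewrite ge_min lexx orbT.
  exists (shift (dist v)); split.
  + apply/supported_coverP; split=> //; last by move=> u; apply: supp.
    * move=> u; rewrite /shift; have := y0 u; case: ifP => [_|_]; [lra|].
      by case: ifP => [/lo_le|_]; lra.
    * move=> u w /yE; rewrite /shift.
      move: (caseP u) (caseP w) =>
        [[lu hu u0 u1]|[hu lu u0 u1]|[lu hu /half_valuedP u0]]
        [[lw hw w0 w1]|[hw lw w0 w1]|[lw hw /half_valuedP w0]];
        try (have := lo_le _ lu); try (have := hi_le _ hu);
        try (have := lo_le _ lw); try (have := hi_le _ hw);
        rewrite ?hu ?lu ?hw ?lw ?(negPf hu) ?(negPf lu) ?(negPf hw) ?(negPf lw);
        try (case: u0); try (case: w0); lra.
  + move=> u; rewrite /shift; have := y1 u; case: ifP => [/hi_le|_]; [lra|].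
    by case: ifP => _; lra.
  + by rewrite sum_shift; have := mulr_ge0_le0 dv (ltW d_le0); lra.
  + apply: (progress _ v) => //; apply/half_valuedP.
    rewrite /shift /dist; move: (caseP v) => [[-> /negPf-> v1 v2]|[-> _ v1 v2]|[_ _ h]].
    * by rewrite min_l; [constructor 1|]; lra.
    * by rewrite min_r; [constructor 3|]; lra.
    * by rewrite h in nv.
Qed.

(** Capping at 1 supplies the bound that the rounding step needs; the step is then iterated, by
    induction on the number of vertices that are not half-valued. *)
Lemma half_valued_rounding M y : supported_cover adj M y ->
  exists z, [/\ supported_cover adj M z, forall v, half_valued (z v) &
    \sum_v z v <= \sum_v y v].
Proof.
move=> sMy.
suff rounding n : forall z, (#|[set v | ~~ half_valued (z v)]| < n)%N ->
    supported_cover adj M z -> (forall v, z v <= 1) ->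
    exists z', [/\ supported_cover adj M z', forall v, half_valued (z' v) &
      \sum_v z' v <= \sum_v z v].
  have [|z [sz hz le]] := rounding _ _ (ltnSn _) (supported_cover_min1 sMy).
    by move=> v; rewrite ge_min lexx orbT.
  exists z; split=> //; apply: le_trans le _; apply: ler_sum => v _.
  by rewrite ge_min lexx.
elim: n => // n IHn z; rewrite ltnS => zn sMz z1.
have [/forallP hz|] := boolP [forall v, half_valued (z v)]; first by exists z.
rewrite negb_forall => /existsP[v nv].
have [z' [sz' z'1 le lt]] := half_valued_step sMz z1 (ex_intro _ v nv).
have [z'' [sz'' hz'' le']] := IHn z' (leq_trans lt zn) sz' z'1.
by exists z''; split=> //; apply: le_trans le.
Qed.

End HalfIntegrality.

(** * Alternating paths and the zeros of a cover *)

Section Optimum.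
Variables (R : realType) (V : finType) (adj : rel V).
Hypotheses (adj_sym : symmetric adj) (adj_irr : irreflexive adj).
Implicit Types (M : {set {set V}}) (y : V -> R) (c : {set V} -> R).

(** One step is two edges of an alternating path, the second in [M], so that the relation lives on
    the zeros of [y]. *)
Definition alt_step M y : rel V := fun z s =>
  [&& y z == 0, y s == 0 & [exists t, adj z t && ([set t; s] \in M)]].

(* Exchange the edges along the path one by one: since [y] alternates between 0
   and at least 1 along it, no exchange destroys a later matching edge. *)
Lemma alt_path_GE_X y : (forall u v, adj u v -> 1 <= y u + y v) ->
  forall p r M, max_matching adj M -> r \notin cover M ->
  path (alt_step M y) r p -> uniq (r :: p) -> last r p \in GE_X adj.
Proof.
move=> yE; elim=> [|s p IHp] r M mM rM.
  by move=> _ _; rewrite inE; apply/existsP; exists M; rewrite mM.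
move=> /= /andP[/and3P[/eqP yr /eqP ys /existsP[t /andP[rt tsM]]] sp].
rewrite inE negb_or => /andP[/andP[rs rp] /andP[sNp up]].
have yt : 1 <= y t by have := yE _ _ rt; rewrite yr add0r.
have ts : s != t by apply: contraTneq yt => <-; rewrite ys ler10.
have /andP[mM' /eqP cM] := mM.
(* [N] covers [r] and exposes [s] instead, so the rest of the path starts at an exposed vertex of
   [N]. *)
pose N := [set r; t] |: M :\ [set t; s].
have rtE : [set r; t] \in edges adj by apply/edgesP; exists r, t.
have [|mN cN] := matching_swap mM' rtE tsM.
  move=> v; rewrite !inE => /orP[]/eqP->; rewrite ?eqxx // => rM'.
  by rewrite rM' in rM.
apply: (IHp s N); last by rewrite /= sNp.
- by rewrite /max_matching mN cN cM eqxx.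
- apply/negP => /bigcupP[e].
  rewrite !inE => /orP[/eqP->|/andP[ne eM] se].
    by rewrite !inE eq_sym (negPf rs) (negPf ts).
  by case/eqP: ne; apply: (matching_eq mM' eM tsM se); rewrite !inE eqxx orbT.
(* A later matching edge ends in a zero [x] other than [s]. It differs from the removed edge [ts],
   because [x] is not [t] either, [y t] being at least 1. *)
- suff keep q z : s \notin q -> path (alt_step M y) z q -> path (alt_step N y) z q.
    exact: keep.
  elim: q z => //= x q IHq z; rewrite inE negb_or => /andP[sx sq].
  move=> /andP[/and3P[y0z /eqP ysx /existsP[w /andP[zw wxM]]] /(IHq _ sq) ->].
  rewrite andbT /alt_step y0z ysx eqxx /=; apply/existsP; exists w; rewrite zw /=.
  rewrite !inE wxM andbT; apply/orP; right; apply/eqP => /setP/(_ x).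
  rewrite !inE eqxx orbT => /esym/orP[]/eqP ex; last by rewrite ex eqxx in sx.
  by move: yt; rewrite -ex ysx ler10.
Qed.

(* Raising by 1/2 the zeros which no alternating path from an exposed vertex
   reaches, and lowering their mates by 1/2, preserves the total. *)
Lemma zeros_in_GE_X M y : max_matching adj M -> supported_cover adj M y ->
  (forall v, half_valued (y v)) ->
  exists z, [/\ supported_cover adj M z, forall v, half_valued (z v),
    \sum_v z v <= \sum_v y v & forall v, z v = 0 -> v \in GE_X adj].
Proof.
move=> mM /supported_coverP[mM' y0 yE yM] hy.
pose A := [set v | [exists r, (r \notin cover M) && connect (alt_step M y) r v]].
pose S := [set v | (y v == 0) && (v \notin A)].
pose T := [set t | [exists s, (s \in S) && ([set s; t] \in M)]].
have AX v : v \in A -> v \in GE_X adj.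
  rewrite inE => /existsP[r /andP[rM /connectP[p rp ->]]].
  case: (shortenP rp) => q rq uq _.
  exact: (alt_path_GE_X yE mM rM rq uq).
have exposedA v : v \notin cover M -> v \in A.
  by move=> vM; rewrite inE; apply/existsP; exists v; rewrite vM connect0.
(* A half-valued neighbour of the zero [s] has value 1. Every zero adjacent to [t] is unreached like
   [s], since a path reaching it would continue through [t] to [s]. *)
have TP t : t \in T -> y t = 1 /\ forall z, y z = 0 -> adj z t -> z \in S.
  rewrite inE => /existsP[s /andP[]]; rewrite inE => /andP[/eqP ys sA] stM.
  have yt : y t = 1.
    have := yE _ _ (edges_adj adj_sym adj_irr (matching_edges mM' stM)); rewrite ys.
    by have /half_valuedP[] := hy t; lra.
  split=> // z yz zt; rewrite inE yz eqxx /=; apply: contra sA.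
  rewrite !inE => /existsP[r /andP[rM rz]]; apply/existsP; exists r; rewrite rM.
  apply: connect_trans rz _; apply: connect1; rewrite /alt_step yz ys eqxx /=.
  by apply/existsP; exists t; rewrite zt setUC.
have SP s : s \in S -> y s = 0 by rewrite inE => /andP[/eqP].
have ST v : v \in S -> v \notin T.
  by move=> /SP yv; apply/negP => /TP[]; rewrite yv => /esym/eqP; rewrite oner_eq0.
pose z v : R := y v + (v \in S)%:R / 2 - (v \in T)%:R / 2.
have zS v : v \in S -> z v = 1 / 2.
  by move=> vS; rewrite /z vS (negPf (ST v vS)) SP //=; lra.
have zT v : v \in T -> z v = 1 / 2.
  move=> vT; have vS : v \notin S by apply: contraL vT; apply: ST.
  by rewrite /z vT (negPf vS) (TP v vT).1 /=; lra.
have zO v : v \notin S -> v \notin T -> z v = y v.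
  by move=> /negPf vS /negPf vT; rewrite /z vS vT /=; lra.
exists z; split.
- apply/supported_coverP; split=> //.
  + move=> v; have [/zS->|vS] := boolP (v \in S); first lra.
    by have [/zT->|vT] := boolP (v \in T); [lra|rewrite zO].
  (* Only vertices of [T] lose value, down to 1/2, and their neighbours end with at least 1/2,
     because all zeros among these lie in [S] and are raised. *)
  + have mono v : v \notin T -> y v <= z v.
      have [vS _|vS vT] := boolP (v \in S); first by rewrite SP // zS //; lra.
      by rewrite zO.
    have half u v : u \in T -> adj u v -> 1 / 2 <= z v.
      move=> uT uv; have [/zT->//|vT] := boolP (v \in T).
      have [/zS->//|vS] := boolP (v \in S); rewrite zO //.
      have /half_valuedP[yv|->//|->] := hy v; last lra.
      by case/negP: vS; apply: (TP u uT).2 => //; rewrite adj_sym.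
    move=> u v uv; have [uT|uT] := boolP (u \in T).
      by have := half u v uT uv; rewrite (zT u) //; lra.
    have [vT|vT] := boolP (v \in T).
      by have := half v u vT; rewrite adj_sym => /(_ uv); rewrite (zT v) //; lra.
    by apply: le_trans (yE _ _ uv) _; apply: lerD; apply: mono.
  + move=> v vM; have yv := yM v vM.
    have vS : v \notin S by rewrite inE exposedA // andbF.
    have vT : v \notin T.
      rewrite inE; apply: contra vM => /existsP[s /andP[_ svM]].
      by apply: (mem_cover svM); rewrite !inE eqxx orbT.
    by rewrite zO.
- move=> v; have [/zS->|vS] := boolP (v \in S); first by apply/half_valuedP; constructor 2.
  by have [/zT->|vT] := boolP (v \in T); [apply/half_valuedP; constructor 2|rewrite zO].
- rewrite /z sumrB big_split /= -!mulr_suml -!natr_sum -!big_mkcond /= !sum1_card.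
  (* The total changes by half of [|S| - |T|], and the matching injects [S] into [T]. *)
  suff: #|S|%:R <= #|T|%:R :> R by lra.
  (* The default [s] is never taken on [S]: exposed vertices lie in [A], so those of [S] are
     covered. *)
  pose mate s := odflt s [pick t | [set s; t] \in M].
  have mateP s : s \in S -> [set s; mate s] \in M.
    move=> sS; rewrite /mate; case: pickP => //= noM.
    have sM : s \in cover M.
      by apply/negPn/negP => /exposedA sA; move: sS; rewrite inE sA andbF.
    by have [t [_ stM]] := matching_mem adj_sym mM' sM; have := noM t; rewrite stM.
  have mateT s : s \in S -> mate s \in T.
    by move=> sS; rewrite inE; apply/existsP; exists s; rewrite sS mateP.
  have mate_inj : {in S &, injective mate}.
    move=> s s' sS s'S emate; have sM := mateP s sS; have s'M := mateP s' s'S.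
    have /setP/(_ s) : [set s; mate s] = [set s'; mate s'].
      by apply: (matching_eq (v := mate s) mM' sM s'M); rewrite !inE ?emate eqxx orbT.
    rewrite !inE eqxx /= => /esym/orP[]/eqP // es.
    by have := ST s sS; rewrite {1}es mateT.
  rewrite ler_nat -(card_in_imset mate_inj); apply: subset_leq_card.
  by apply/subsetP => _ /imsetP[s sS ->]; apply: mateT.
(* On [S] and [T] the new value is 1/2, so a zero of [z] is a zero of [y] outside [S], hence
   reached. *)
- move=> v zv; apply: AX; apply/negPn/negP => vA.
  have [/zS zv'|vS] := boolP (v \in S); first lra.
  have [/zT zv'|vT] := boolP (v \in T); first lra.
  by rewrite zO // in zv; case/negP: vS; rewrite inE zv eqxx.
Qed.

(** * Existence and half-integrality of an optimal solution *)

Lemma eq_supported_cover M y z : y =1 z ->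
  supported_cover adj M y -> supported_cover adj M z.
Proof.
move=> eyz /supported_coverP[mM y0 yE yM]; apply/supported_coverP; split=> //.
- by move=> v; rewrite -eyz.
- by move=> u v uv; rewrite -!eyz; apply: yE.
- by move=> v vM; rewrite -eyz; apply: yM.
Qed.

(** Each edge meets the cover of a maximum matching. This pair is the candidate that shows the
    minimisation to be over a nonempty set. *)
Lemma supported_cover_max_matching M : max_matching adj M ->
  supported_cover adj M (fun v => (v \in cover M)%:R : R).
Proof.
move=> mM; apply/supported_coverP; split=> //.
- by case/andP: mM.
- move=> u v uv; have uvE : [set u; v] \in edges adj by apply/edgesP; exists u, v.
  have [w] := max_matching_maximal mM uvE.
  by rewrite !inE => /orP[]/eqP-> ->; rewrite ?lerDl ?lerDr ler0n.
- by move=> v /negPf->.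
Qed.

(** Rounding keeps the matching and does not raise the total, so a minimum over the finitely many
    half-valued pairs is a minimum over all pairs. *)
Lemma half_supported_minimum : exists M y,
  [/\ supported_cover adj M y, forall v, half_valued (y v) &
  forall N z, supported_cover adj N z ->
    \sum_v y v - #|M|%:R <= \sum_v z v - #|N|%:R].
Proof.
(* Halving the elements of ['I_3] gives 0, 1/2 and 1, so half-valued functions are coded by a finite
   type. *)
pose val (f : {ffun V -> 'I_3}) v : R := (f v)%:R / 2.
have val_half f v : half_valued (val f v).
  apply/half_valuedP; rewrite /val; case: (f v) => -[|[|[|//]]] i /=.
  - by constructor 1; rewrite mul0r.
  - by constructor 2.
  - by constructor 3; rewrite divff // pnatr_eq0.
have val_surj z : (forall v, half_valued (z v)) -> exists f, val f =1 z.
  move=> hz; exists [ffun v => if z v == 0 then inord 0 else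
    if z v == 1 / 2 then inord 1 else inord 2] => v.
  rewrite /val ffunE; have := hz v; rewrite /half_valued.
  case: eqP => [->|_]; first by rewrite inordK // mul0r.
  case: eqP => [->|_]; first by rewrite inordK.
  by move=> /eqP->; rewrite inordK // divff // pnatr_eq0.
pose P (x : {set {set V}} * {ffun V -> 'I_3}) := supported_cover adj x.1 (val x.2).
pose cost (x : {set {set V}} * {ffun V -> 'I_3}) : R :=
  \sum_v val x.2 v - #|x.1|%:R.
have [M0 mM0] := max_matching_exists adj.
have [v|f0 ef0] := val_surj (fun v => (v \in cover M0)%:R).
  by rewrite /half_valued; case: (v \in cover M0); rewrite eqxx ?orbT.
have P0 : P (M0, f0).
  apply: eq_supported_cover (supported_cover_max_matching mM0).
  by move=> v; rewrite -ef0.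
case: (@arg_minP _ R _ (M0, f0) P cost P0) => -[M f] PMf min.
exists M, (val f); split=> // N z /half_valued_rounding[z' [sz' /val_surj[g eg] le]].
have := min (N, g); rewrite /P /= => /(_ _)/le_trans; apply.
  by apply: eq_supported_cover sz' => v; rewrite eg.
by rewrite /cost /= lerD2r (eq_bigr _ (fun v _ => eg v)).
Qed.

(** A feasible triple costs at least [z(V) - |N|], the excess being its subsidy off [N], while the
    tight subsidy attains this value. *)
Lemma minimum_optimal M y : supported_cover adj M y ->
  (forall N z, supported_cover adj N z ->
    \sum_v y v - #|M|%:R <= \sum_v z v - #|N|%:R) ->
  optimal adj M y (tight_subsidy M y).
Proof.
move=> sMy min; have [f sumc] := supported_feasible adj_irr sMy.
split=> // N z c fc; have [sNz cN] := feasible_supported adj_irr fc.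
have [c0 mN _ _] := fc.
rewrite sumc (sum_subsidy c mN) (sum_tight sNz cN).
apply: le_trans (min _ _ sNz) _; rewrite lerDl.
by apply: sumr_ge0 => e /andP[eE _]; apply: c0.
Qed.

Lemma half_valued_integral (x : R) : half_valued x -> half_integral x.
Proof.
move=> /half_valuedP[->|->|->]; [exists 0|exists 1|exists 2] => //.
  by rewrite mul0r.
by rewrite divff // pnatr_eq0.
Qed.

Lemma tight_subsidy_half M y e : (forall v, half_valued (y v)) ->
  e \in edges adj -> half_integral (tight_subsidy M y e).
Proof.
move=> hy eE; rewrite /tight_subsidy; case: ifP => _; last first.
  by exists 0; rewrite mul0r.
have [u [v [_ _ ->]]] := sum_edge adj_irr y eE.
have [k ->] := half_valued_integral (hy u).
have [l ->] := half_valued_integral (hy v).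
(* The subsidy on the edge is [k / 2 + l / 2 - 1]. *)
by exists (k + l - 2); rewrite !rmorphB !rmorphD /=; lra.
Qed.

End Optimum.

(** * Structure of all optimal solutions and a half-integral one *)

Theorem theorem5 (R : realType) (V : finType) (adj : rel V)
    (adj_sym : symmetric adj) (adj_irr : irreflexive adj) :
  (forall (M : {set {set V}}) (y : V -> R) (c : {set V} -> R),
     optimal adj M y c ->
     [/\ forall e, e \in edges adj -> e \notin M -> c e = 0,
         forall e, e \in M -> 0 <= c e <= 1
       & #|M| = nu adj]) /\
  (exists (M : {set {set V}}) (y : V -> R) (c : {set V} -> R),
     [/\ optimal adj M y c,
         forall e, e \in edges adj -> half_integral (c e),
         forall v, [\/ y v = 0, y v = 1 / 2 | y v = 1]
       & forall v, v \in GE_Y adj -> 0 < y v]).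
Proof.
split; first by move=> M y c; apply: optimal_structure.
have [M [y [sMy hy min]]] := half_supported_minimum R adj.
(* Part (i), applied to the minimum just found, makes [M] a maximum matching, as the alternating
   paths require. *)
have [_ _ cM] := optimal_structure adj_sym adj_irr (minimum_optimal adj_irr sMy min).
have mM : max_matching adj M.
  by rewrite /max_matching cM eqxx andbT; case/supported_coverP: sMy.
have [z [sMz hz le zX]] := zeros_in_GE_X adj_sym adj_irr mM sMy hy.
exists M, z, (tight_subsidy M z); split.
- apply: minimum_optimal => // N x /min; apply: le_trans.
  by rewrite lerD2r.
- by move=> e; apply: tight_subsidy_half.
- by move=> v; apply/half_valuedP.
(* The zeros of [z] lie in [GE_X adj], which is disjoint from [GE_Y adj]. *)
- have /supported_coverP[_ z0 _ _] := sMz.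
  move=> v; rewrite inE => /andP[vX _]; rewrite lt_def z0 andbT.
  by apply: contraNneq vX => /zX.
Qed.
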